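(* Let $n$ and $\alpha$ be integers with $\alpha \geq \lceil n/2 \rceil$ and let $\sigma \in [0,1)$. If $G^*$ is an $A_\sigma$-minimizer graph in $\mathcal{G}_{n,\alpha}$, then $G^*$ is a tree.
   Context: All graphs are finite, simple and connected. For a graph $G$ with adjacency matrix $A(G)$ and diagonal degree matrix $D(G)$, and $\sigma\in[0,1]$, set $A_\sigma(G)=\sigma D(G)+(1-\sigma)A(G)$; its largest eigenvalue $\lambda_\sigma(G)$ is the $A_\sigma$ spectral radius. $\mathcal{G}_{n,\alpha}$ denotes the family of all connected graphs on $n$ vertices with independence number $\alpha$. A graph in $\mathcal{G}_{n,\alpha}$ is an $A_\sigma$-minimizer graph if it attains the minimum of $\lambda_\sigma$ over $\mathcal{G}_{n,\alpha}$. *)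

(* Defs.v *)
From HB Require Import structures.
From mathcomp Require Import all_boot all_order all_algebra.
From mathcomp Require Import complex boolp classical_sets reals.
Set Implicit Arguments. Unset Strict Implicit. Unset Printing Implicit Defensive.
Import Order.TTheory GRing.Theory Num.Theory.
Local Open Scope ring_scope.

Record sgraph (n : nat) := SGraph {
  adj :> rel 'I_n;
  adj_sym : symmetric adj;
  adj_irrefl : irreflexive adj }.

Section Graphs.
Context {n : nat}.
Implicit Types G H : sgraph n.

(* The graph without vertices is not connected. *)
Definition connected G : Prop :=
  (0 < n)%N /\ forall x y : 'I_n, connect G x y.

(* [ucycle] also accepts the sequences of size at most 2, which are not cycles
   of a simple graph. *)
Definition acyclic G : Prop :=
  forall c : seq 'I_n, (2 < size c)%N -> ~ ucycle G c.

Definition is_tree G : Prop := connected G /\ acyclic G.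

Definition independent G (S : {set 'I_n}) : bool :=
  [forall x in S, forall y in S, ~~ G x y].

Definition independence_number G : nat :=
  \max_(S : {set 'I_n} | independent G S) #|S|.

Definition degree G (x : 'I_n) : nat := #|[set y | G x y]|.

(* The family G_{n,alpha}, the vertex set being fixed as 'I_n. *)
Definition in_family (alpha : nat) G : Prop :=
  connected G /\ independence_number G = alpha.

Variable R : realType.
Implicit Types sigma : R.

Definition adjacency_mx G : 'M[R]_n := \matrix_(x, y) (G x y)%:R.

Definition degree_mx G : 'M[R]_n := diag_mx (\row_x (degree G x)%:R).

Definition Asigma sigma G : 'M[R]_n :=
  sigma *: degree_mx G + (1 - sigma) *: adjacency_mx G.

(* [sup] is a genuine maximum here when 0 < n: see [lambda_eigenvalue] and
   [lambda_ge] below. *)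
Definition lambda sigma G : R :=
  sup [set a : R | eigenvalue (Asigma sigma G) a]%classic.

Definition minimizer sigma (alpha : nat) G : Prop :=
  in_family alpha G /\
  forall H, in_family alpha H -> lambda sigma G <= lambda sigma H.

Lemma Asigma_sym sigma G : (Asigma sigma G)^T = Asigma sigma G.
Proof.
rewrite /Asigma linearD /= !linearZ /= tr_diag_mx; congr (_ + _ *: _).
by apply/matrixP => x y; rewrite !mxE adj_sym.
Qed.

Lemma sym_eigenvalue (A : 'M[R]_n) :
  (0 < n)%N -> A^T = A -> exists a, eigenvalue A a.
Proof.
move=> n0 sA; pose f := real_complex R; pose B := map_mx f A.
have [c /eigenvalueP [v Bv v0]] := spectral.eigenvalue_closed B n0.
have sB : B^T = B by rewrite /B map_trmx sA.
have cB : map_mx Num.conj B = B.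
  apply/matrixP => i j; rewrite !mxE; apply/CrealP.
  by apply/complex_realP; exists (A i j).
pose w := map_mx Num.conj v.
have Bw : w *m B = c^* *: w by rewrite -{1}cB -map_mxM Bv map_mxZ.
have E : c *: (v *m w^T) = c^* *: (v *m w^T).
  by rewrite scalemxAl -Bv -mulmxA -{1}sB -trmx_mul Bw linearZ /= -scalemxAr.
have N : (v *m w^T) 0 0 != 0.
  rewrite mxE (eq_bigr (fun i => `|v 0 i| ^+ 2)); last first.
    by move=> i _; rewrite !mxE normCK.
  apply: contra v0 => /eqP /psumr_eq0P P; apply/eqP/matrixP => i j.
  rewrite ord1 mxE; apply/eqP; rewrite -normr_eq0 -sqrf_eq0.
  by rewrite P // => k _; rewrite exprn_ge0.
have cc : c^* = c.
  by move/matrixP: E => /(_ 0 0); rewrite [LHS]mxE [RHS]mxE => /(mulIf N).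
have /complex_realP [a ca] : c \is Num.real by apply/CrealP.
exists a; rewrite eigenvalue_root_char -(fmorph_root f) map_char_poly -eigenvalue_root_char; apply/eigenvalueP.
by exists v => //; rewrite Bv ca.
Qed.

Lemma eigenvalue_sup (A : 'M[R]_n) : (0 < n)%N -> A^T = A ->
  let l := sup [set a : R | eigenvalue A a]%classic in
  eigenvalue A l /\ forall a, eigenvalue A a -> a <= l.
Proof.
move=> n0 sA l; have [a0 ea0] := sym_eigenvalue n0 sA.
have pA0 : char_poly A != 0 by rewrite monic_neq0 ?char_poly_monic.
pose P (k : nat) := `[< exists s : seq R,
  [/\ size s = k, uniq s & all (eigenvalue A) s] >].
have [M eM maxM] : exists2 M, eigenvalue A M &
    forall a, eigenvalue A a -> a <= M.
  have [s [us es ms]] : exists s : seq R,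
      [/\ uniq s, all (eigenvalue A) s &
          forall a, eigenvalue A a -> a \in s].
    have exP : exists k, P k by exists 0%N; apply/asboolP; exists [::].
    have ubP k : P k -> (k <= size (char_poly A))%N.
      move=> /asboolP [s [<- us es]]; apply: ltnW; apply: max_poly_roots => //.
      by apply/allP => x /(allP es); rewrite eigenvalue_root_char.
    case: (ex_maxnP exP ubP) => k /asboolP [s [sk us es]] maxk.
    exists s; split=> // a ea; apply: contraT => nas.
    suff /maxk : P k.+1 by rewrite ltnn.
    by apply/asboolP; exists (a :: s); rewrite /= sk nas us ea es.
  exists (\big[Num.max/a0]_(x <- s) x).
    rewrite big_seq; apply: (big_ind (fun x => eigenvalue A x)) => //.
      by move=> x y ex ey; case: (leP x y).
    by move=> x; apply/allP.
  by move=> a /ms ax; exact: le_bigmax_seq.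
suff -> : l = M by [].
apply/eqP; rewrite eq_le; apply/andP; split.
  by apply: ge_sup; [exists M | move=> a; exact: maxM].
by apply: ub_le_sup; [exists M => a; exact: maxM | exact: eM].
Qed.

Lemma lambda_eigenvalue sigma G :
  (0 < n)%N -> eigenvalue (Asigma sigma G) (lambda sigma G).
Proof. by move=> n0; case: (eigenvalue_sup n0 (Asigma_sym sigma G)). Qed.

Lemma lambda_ge sigma G a :
  (0 < n)%N -> eigenvalue (Asigma sigma G) a -> a <= lambda sigma G.
Proof. by move=> n0; case: (eigenvalue_sup n0 (Asigma_sym sigma G)) => _; apply. Qed.

End Graphs.

(* Main.v *)
Require Import Defs.
From mathcomp Require Import all_boot all_order all_algebra reals.
From mathcomp Require Import complex.
From mathcomp Require Import ring lra zify.
Set Implicit Arguments. Unset Strict Implicit. Unset Printing Implicit Defensive.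
Import Order.TTheory GRing.Theory Num.Theory.
Local Open Scope ring_scope.

(** A minimizer G with a cycle loses an edge of that cycle: the graph H obtained
    is connected, its spectral radius is strictly smaller, and its independence
    number is at least alpha. From H one descends to a graph of G_{n,alpha}
    without increasing the spectral radius, a contradiction. Each step either
    deletes an edge that is not a bridge, or takes a maximal pendant path
    v, ..., p ending in a leaf p, where v has degree at least 3, and moves one of
    the other edges at v to p. The independence number drops by at most one per
    step and the sum of the squared degrees decreases, so the descent hits the
    value alpha, unless it ends in a Hamiltonian path; but then the independence
    number is at most ceil(n/2) <= alpha anyway. *)

(** * Rayleigh quotients of real symmetric matrices *)

Section Rayleigh.
Local Open Scope sesquilinear_scope.
Variables (R : realType) (n : nat) (A : 'M[R]_n) (l : R).
Hypothesis symA : A^T = A.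
Hypothesis le_l : forall a, eigenvalue A a -> a <= l.

(** Over the complex numbers [A] is Hermitian, hence unitarily diagonalizable; in the new
    coordinates the form is a sum of squared moduli weighted by eigenvalues, each at most [l]. *)
Lemma rayleigh_le (x : 'rV[R]_n) :
  (x *m A *m x^T) 0 0 <= l * (x *m x^T) 0 0.
Proof.
pose f := real_complex R; pose B := map_mx f A.
have realf (m k : nat) (M : 'M[R]_(m, k)) : (map_mx f M)^t* = (map_mx f M)^T.
  apply/matrixP => i j; rewrite !mxE; apply/CrealP.
  by apply/complex_realP; exists (M j i).
have hB : B \is hermsymmx.
  apply: spectral.realsym_hermsym.
    by apply/is_hermitianmxP; rewrite expr0 scale1r map_mx_id // /B map_trmx symA.
  by apply/mxOverP => i j; rewrite mxE; apply/complex_realP; exists (A i j).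
have /orthomx_spectralP := hermitian_normalmx hB.
have := hermitian_spectral_diag_real hB.
have := spectral_unitarymx B; have := spectral_unit B.
set P := spectralmx B; set d := spectral_diag B => Pu Punit /mxOverP dreal BE.
have PP : invmx P = P^t* by apply: invmx_unitary.
(* Row [i] of the invertible [P] is a nonzero eigenvector for [d 0 i]. As this value is real, the
   characteristic polynomial carries it back to an eigenvalue of [A] over [R]. *)
have dE i : d 0 i <= f l.
  have /complex_realP [a da] : d 0 i \is Num.real by apply: dreal.
  rewrite -/(f a) in da; rewrite da lecR; apply: le_l.
  rewrite eigenvalue_root_char -(fmorph_root f) map_char_poly -eigenvalue_root_char.
  apply/eigenvalueP; exists (row i P).
    rewrite -/B BE -!row_mul !mulmxA mulmxV // mul1mx.
    by rewrite row_mul row_diag_mx -scalemxAl -rowE da.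
  apply/eqP => Pi0; have := mulmxV Pu => /(congr1 (row i)).
  rewrite row_mul Pi0 mul0mx => /rowP /(_ i); rewrite !mxE eqxx => /eqP.
  by rewrite eq_sym oner_eq0.
pose Y := map_mx f x *m P^t*.
have YE : Y^t* = P *m map_mx f x^T.
  by rewrite /Y trmx_mul map_mxM trmxCK realf map_trmx.
have q1 : map_mx f (x *m A *m x^T) = Y *m diag_mx d *m Y^t*.
  by rewrite !map_mxM /= -/B BE PP YE !mulmxA.
have q2 : map_mx f (x *m x^T) = Y *m Y^t*.
  by rewrite !map_mxM /= YE mulmxA -(mulmxA _ _ P) -PP mulVmx // mulmx1.
rewrite -lecR rmorphM /=.
have -> : ((x *m A *m x^T) 0 0)%:C%C = map_mx f (x *m A *m x^T) 0 0 by rewrite !mxE.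
have -> : ((x *m x^T) 0 0)%:C%C = map_mx f (x *m x^T) 0 0 by rewrite !mxE.
rewrite q1 q2 mxE [X in _ * X]mxE mulr_sumr; apply: ler_sum => i _.
rewrite mul_mx_diag !mxE [_ * d 0 i]mulrC -mulrA -normCK.
by apply: ler_wpM2r => //; rewrite exprn_ge0.
Qed.

(* [l%:M - A] is positive semidefinite and its form vanishes at [x]; following
   the form along [x + t *: (x *m (l%:M - A))] for a small negative [t] forces
   [x *m (l%:M - A) = 0]. *)
Lemma rayleigh_eq (x : 'rV[R]_n) :
  (x *m A *m x^T) 0 0 = l * (x *m x^T) 0 0 -> x *m A = l *: x.
Proof.
move=> xE.
have eD (M N : 'M[R]_1) : (M + N) 0 0 = M 0 0 + N 0 0 by rewrite mxE.
have eZ t (M : 'M[R]_1) : (t *: M) 0 0 = t * M 0 0 by rewrite mxE.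
have bilin (M : 'M[R]_n) (y z : 'rV[R]_n) t :
    ((y + t *: z) *m M *m (y + t *: z)^T) 0 0 = (y *m M *m y^T) 0 0
    + t * (y *m M *m z^T) 0 0 + t * (z *m M *m y^T) 0 0
    + t ^+ 2 * (z *m M *m z^T) 0 0.
  have -> : (y + t *: z)^T = y^T + t *: z^T by apply/matrixP => i j; rewrite !mxE.
  rewrite !mulmxDl !mulmxDr -!scalemxAl -!scalemxAr !(eD, eZ); ring.
pose B := l%:M - A; pose q (y z : 'rV[R]_n) := (y *m B *m z^T) 0 0.
have qE y : q y y = l * (y *m y^T) 0 0 - (y *m A *m y^T) 0 0.
  by rewrite /q /B mulmxBr mul_mx_scalar mulmxBl -scalemxAl !mxE.
have psd y : 0 <= q y y by rewrite qE subr_ge0 rayleigh_le.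
pose z := x *m B.
have qs y t : q y t = q t y.
  rewrite /q -[LHS]/((y *m B *m t^T) 0 0) -[y *m B *m t^T]trmxK [LHS]mxE.
  by rewrite !trmx_mul trmxK mulmxA linearB /= tr_scalar_mx symA.
have qD t : q (x + t *: z) (x + t *: z) = t * (q x z *+ 2) + t ^+ 2 * q z z.
  have q0 : q x x = 0 by rewrite qE xE subrr.
  rewrite [RHS](_ : _ = q x x + t * q x z + t * q z x + t ^+ 2 * q z z).
    exact: bilin.
  by rewrite (qs z x) q0; ring.
have N0 : q x z = (z *m z^T) 0 0 by [].
suff z0 : q x z = 0.
  apply/esym/eqP; rewrite -subr_eq0 -mul_mx_scalar -mulmxBr -/z.
  apply/eqP/rowP => i; rewrite [RHS]mxE; move: z0; rewrite N0 mxE.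
  under eq_bigr do rewrite [z^T _ _]mxE -expr2.
  move/(psumr_eq0P (fun k _ => sqr_ge0 (z 0 k)))/(_ i isT)/eqP.
  by rewrite sqrf_eq0 => /eqP.
apply/eqP; case: eqP => // /eqP N1.
(* The [+ 1] keeps the denominator positive even if [q z z = 0]. With [s] the quotient, the form
   equals [- s ^+ 2 * (q z z + 2)], which is negative. *)
have c0 := psd z; have := psd (x - (q x z / (q z z + 1)) *: z).
have c1 : 0 < q z z + 1 by rewrite ltr_wpDl.
rewrite -scaleNr qD.
have -> : - (q x z / (q z z + 1)) * (q x z *+ 2) +
   (- (q x z / (q z z + 1))) ^+ 2 * q z z =
   - (q x z / (q z z + 1)) ^+ 2 * (q z z + 2).
  by field; rewrite gt_eqF.
have : 0 < (q x z / (q z z + 1)) ^+ 2.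
  by rewrite exprn_even_gt0 //= mulf_neq0 // invr_eq0 gt_eqF.
by move=> ? ; nra.
Qed.
End Rayleigh.

(** * The quadratic form of a graph, Perron vectors and comparison of spectral radii *)

Section QuadraticForm.
Variables (R : realType) (n : nat) (sigma : R).
Implicit Types (G H : sgraph n) (e : rel 'I_n) (x : 'I_n -> R).

(** The share of a single edge in the quadratic form: the degree matrix gives [sigma] times a square
    at each end, the adjacency matrix gives the mixed term. *)
Definition edge_form (s t : R) : R :=
  sigma * (s ^+ 2 + t ^+ 2) + 2 * (1 - sigma) * (s * t).

(* Every edge is counted in both directions, so [quad G x] is twice the value
   of the quadratic form of [Asigma sigma G] at [x]. *)
Definition quad e x : R :=
  \sum_a \sum_b (e a b)%:R * edge_form (x a) (x b).

Definition sqnorm x : R := \sum_a x a ^+ 2.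

Lemma edge_formC s t : edge_form s t = edge_form t s.
Proof. by rewrite /edge_form addrC [t ^+ 2 + _]addrC [t * s]mulrC addrC. Qed.

Lemma AsigmaE G a b : Asigma sigma G a b =
  sigma * (degree G b)%:R *+ (a == b) + (1 - sigma) * (G a b)%:R.
Proof.
by rewrite !mxE -mulrnAr; case: eqP => [->|].
Qed.

Lemma degreeE G b : (degree G b)%:R = \sum_a (G a b)%:R :> R.
Proof.
rewrite /degree -sum1_card big_mkcond natr_sum; apply: eq_bigr => a _.
by rewrite inE adj_sym; case: (G a b).
Qed.

Lemma quadE G x (X := \row_a x a : 'rV[R]_n) :
  quad G x = (X *m Asigma sigma G *m X^T) 0 0 *+ 2.
Proof.
have -> : (X *m Asigma sigma G *m X^T) 0 0 =
    \sum_b \sum_a (sigma * (G a b)%:R * x b ^+ 2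
                   + (1 - sigma) * (G a b)%:R * (x a * x b)).
  rewrite mxE; apply: eq_bigr => b _; rewrite !mxE.
  under eq_bigr do rewrite mxE AsigmaE mulrDr.
  rewrite big_split /= (bigD1 b) //= big1 ?addr0; last first.
    by move=> a /negbTE ->; rewrite mulr0.
  rewrite eqxx mulr1n big_split /= mulrDl; congr (_ + _).
    by rewrite -mulr_suml -mulr_sumr -degreeE; ring.
  by rewrite mulr_suml; apply: eq_bigr => a _; ring.
have -> : quad G x = \sum_a \sum_b sigma * (G a b)%:R * x b ^+ 2
   + \sum_a \sum_b (sigma * (G a b)%:R * x a ^+ 2
                   + 2 * (1 - sigma) * (G a b)%:R * (x a * x b)).
  rewrite -big_split; apply: eq_bigr => a _; rewrite -big_split.
  by apply: eq_bigr => b _; rewrite /edge_form /=; ring.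
rewrite mulr2n {1}exchange_big /=.
rewrite -big_split -[RHS]big_split /=; apply: eq_bigr => a _.
rewrite -!big_split /=; apply: eq_bigr => b _.
by rewrite [G b a]adj_sym; ring.
Qed.

Lemma sqnormE x (X := \row_a x a : 'rV[R]_n) : sqnorm x = (X *m X^T) 0 0.
Proof. by rewrite mxE; apply: eq_bigr => a _; rewrite !mxE expr2. Qed.

Lemma quad_le_lambda G x :
  (0 < n)%N -> quad G x <= 2 * lambda sigma G * sqnorm x.
Proof.
move=> n0; rewrite quadE sqnormE -mulrA -mulr_natl ler_pM2l //.
by apply: rayleigh_le (Asigma_sym _ _) _ _ => a; apply: lambda_ge.
Qed.

Lemma sqnorm_gt0 x a : x a != 0 -> 0 < sqnorm x.
Proof.
move=> xa; rewrite /sqnorm (bigD1 a) //= ltr_wpDr ?exprn_even_gt0 //.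
by apply: sumr_ge0 => b _; exact: sqr_ge0.
Qed.

Hypotheses (sigma_ge0 : 0 <= sigma) (sigma_lt1 : sigma < 1).

(** Passing to absolute values in an eigenvector keeps the norm and cannot decrease the form, since
    [1 - sigma] is nonnegative; the Rayleigh bound then forces equality. *)
Lemma perron_ge0 G : (0 < n)%N -> exists x : 'I_n -> R,
  [/\ forall a, 0 <= x a, 0 < sqnorm x
    & quad G x = 2 * lambda sigma G * sqnorm x].
Proof.
move=> n0; have /eigenvalueP [v vE v0] := lambda_eigenvalue sigma G n0.
pose y a := v 0 a; pose x a := `|y a|.
have vy : v = \row_a y a by apply/rowP => a; rewrite mxE.
have xy : sqnorm x = sqnorm y by apply: eq_bigr => a _; rewrite real_normK // num_real.
have yp : 0 < sqnorm y.
  by have /rV0Pn [a ya] := v0; exact: (@sqnorm_gt0 y a).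
exists x; split; [by move=> a; exact: normr_ge0|by rewrite xy|].
apply/eqP; rewrite eq_le quad_le_lambda //= xy.
have -> : 2 * lambda sigma G * sqnorm y = quad G y.
  rewrite quadE sqnormE -vy vE -scalemxAl [in RHS]mxE; ring.
apply: ler_sum => a _; apply: ler_sum => b _; apply: ler_wpM2l => //.
rewrite /edge_form /x !real_normK ?num_real // lerD2l -normrM.
by rewrite ler_wpM2l ?ler_norm // mulr_ge0 // subr_ge0 ltW.
Qed.

(** Equality in the Rayleigh bound makes [x] an eigenvector. At a zero entry the eigenvalue equation
    is a vanishing sum of nonnegative terms, so the neighbours vanish too, and by connectedness so
    does all of [x]. *)
Lemma perron_gt0 G x : (0 < n)%N -> connected G ->
  (forall a, 0 <= x a) -> 0 < sqnorm x ->
  quad G x = 2 * lambda sigma G * sqnorm x -> forall a, 0 < x a.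
Proof.
move=> n0 [_ cG] x0 xp xE.
have {}xE : \row_a x a *m Asigma sigma G = lambda sigma G *: \row_a x a.
  apply: rayleigh_eq (Asigma_sym _ _) _ _ _ => [a|]; first exact: lambda_ge.
  apply: (mulfI (_ : 2 != 0)); first by rewrite pnatr_eq0.
  by rewrite mulrA -sqnormE -xE quadE mulr_natl.
have zero_adj a b : G a b -> x a = 0 -> x b = 0.
  move=> ab xa.
  have t0 c : 0 <= x c * Asigma sigma G c a.
    rewrite mulr_ge0 // AsigmaE addr_ge0 ?mulrn_wge0 ?mulr_ge0 //.
    by rewrite subr_ge0 ltW.
  have : \sum_c x c * Asigma sigma G c a = 0.
    have /rowP /(_ a) := xE; rewrite [RHS]mxE [X in _ * X]mxE xa mulr0 mxE; apply: etrans.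
    by apply: eq_bigr => c _; rewrite [in RHS]mxE.
  move=> /(psumr_eq0P (fun c _ => t0 c))/(_ b isT)/eqP.
  rewrite AsigmaE [G b a]adj_sym ab mulr1 mulf_eq0 => /orP [/eqP //|].
  by rewrite gt_eqF // ltr_wpDl ?subr_gt0 // mulrn_wge0 // mulr_ge0.
move=> a; rewrite lt_neqAle x0 andbT eq_sym; apply/eqP => xa.
have all0 b : x b = 0.
  have /connectP [p pP ->] := cG a b.
  elim: p a xa pP => //= c p IH a xa /andP [ac pP].
  by apply: IH => //; apply: zero_adj ac xa.
by move: xp; rewrite /sqnorm big1 ?ltxx // => b _; rewrite all0 expr0n.
Qed.

(** The positive Perron vector of [H] serves as test vector for [G], where the extra edge
    contributes a positive amount. *)
Lemma lambda_lt_sub G H u v : (0 < n)%N -> connected H ->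
  subrel H G -> G u v -> ~~ H u v -> lambda sigma H < lambda sigma G.
Proof.
move=> n0 cH sHG Guv Huv; have [x [x0 xp xE]] := perron_ge0 H n0.
have {}x0 := perron_gt0 n0 cH x0 xp xE.
have f_gt0 a b : 0 < edge_form (x a) (x b).
  have xa := x0 a; have xb := x0 b.
  rewrite /edge_form ltr_wpDl ?mulr_ge0 ?addr_ge0 ?sqr_ge0 //.
  by rewrite !mulr_gt0 // subr_gt0.
suff : quad H x < quad G x.
  move=> /lt_le_trans /(_ (quad_le_lambda G x n0)).
  by rewrite xE ltr_pM2r // ltr_pM2l.
have le_ab a b : (H a b)%:R * edge_form (x a) (x b)
               <= (G a b)%:R * edge_form (x a) (x b).
  apply: ler_wpM2r; first exact: ltW.
  by rewrite ler_nat; have := sHG a b; case: (H a b) => // ->.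
rewrite /quad (bigD1 u) //= [ltRHS](bigD1 u) //=.
apply: ltr_leD; last by apply: ler_sum => a _; apply: ler_sum.
rewrite (bigD1 v) //= [ltRHS](bigD1 v) //=.
apply: ltr_leD; last by apply: ler_sum.
by rewrite (negbTE Huv) Guv mul0r mul1r.
Qed.

(** The last two hypotheses say that [e2] arises from [e1] by handing some neighbours of [u] over to
    [w]. As [x w] is at least [x u], each transferred edge gains weight. *)
Lemma quad_shift (e1 e2 : rel 'I_n) x u w :
  (forall a, 0 <= x a) -> x u <= x w -> u != w ->
  symmetric e1 -> symmetric e2 -> irreflexive e1 -> irreflexive e2 ->
  (forall a b, a \notin [:: u; w] -> b \notin [:: u; w] -> e1 a b = e2 a b) ->
  e1 u w = e2 u w ->
  (forall c, c \notin [:: u; w] -> (e1 u c + e1 w c = e2 u c + e2 w c)%N) ->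
  (forall c, c \notin [:: u; w] -> e1 w c -> e2 w c) ->
  quad e1 x <= quad e2 x.
Proof.
move=> x0 xuw neq_uw s1 s2 i1 i2 out uw sum_eq sub.
pose D a b := ((e2 a b)%:R - (e1 a b)%:R) * edge_form (x a) (x b).
have Dsym a b : D a b = D b a by rewrite /D edge_formC s1 s2.
have Duw c : 0 <= D u c + D w c.
  have [|c_out] := boolP (c \in [:: u; w]).
    rewrite !inE => /orP [] /eqP ->.
      by rewrite /D i1 i2 (s1 w) (s2 w) uw !subrr !mul0r addr0.
    by rewrite /D i1 i2 uw !subrr !mul0r addr0.
  (* What [w] gains at [c] is exactly what [u] loses there. *)
  have -> : D u c + D w c = ((e2 w c)%:R - (e1 w c)%:R)
      * (edge_form (x w) (x c) - edge_form (x u) (x c)).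
    have := congr1 (fun k => k%:R : R) (sum_eq c c_out); rewrite /D !natrD.
    by move=> E; rewrite [(e2 u c)%:R](_ : _ = (e1 u c)%:R + (e1 w c)%:R - (e2 w c)%:R);
       [ring | rewrite E; ring].
  apply: mulr_ge0.
    by rewrite subr_ge0 ler_nat; have := sub c c_out; case: (e1 w c) => // ->.
  rewrite subr_ge0 /edge_form lerD // ler_wpM2l //.
  - by rewrite lerD2r ler_sqr ?nnegrE.
  - by rewrite mulr_ge0 // subr_ge0 ltW.
  - exact: ler_wpM2r.
rewrite -subr_ge0 /quad -sumrB.
under eq_bigr do rewrite -sumrB.
under eq_bigr do under eq_bigr do rewrite -mulrBl -/(D _ _).
(* Rows [u] and [w] are paired by [Duw]; in any other row only columns [u] and [w] survive, and
   symmetry reduces these to [Duw] again. *)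
rewrite (bigD1 u) //= [X in _ + X](bigD1 w) 1?eq_sym //= addrA -big_split /=.
apply: addr_ge0; first exact: sumr_ge0.
apply: sumr_ge0 => a /andP [au aw].
rewrite (bigD1 u) //= (bigD1 w) 1?eq_sym //= addrA big1 => [|b /andP [bu bw]].
  by rewrite addr0 Dsym [D a w]Dsym.
by rewrite /D out ?subrr ?mul0r // !inE negb_or ?au ?bu.
Qed.

End QuadraticForm.

(** * Deleting, adding and moving edges: independence number and connectedness *)

Section EdgeSurgery.
Local Open Scope nat_scope.
Variable n : nat.
Implicit Types (G H : sgraph n) (u v p q a b : 'I_n) (l : seq 'I_n).

Definition is_edge u v : rel 'I_n :=
  fun a b => (a == u) && (b == v) || (a == v) && (b == u).

Lemma is_edge_sym u v : symmetric (is_edge u v).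
Proof.
by move=> a b; rewrite /is_edge orbC [(b == v) && _]andbC [(b == u) && _]andbC.
Qed.

Lemma del_edge_sym G u v : symmetric (fun a b => G a b && ~~ is_edge u v a b).
Proof. by move=> a b; rewrite adj_sym is_edge_sym. Qed.

Lemma del_edge_irrefl G u v : irreflexive (fun a b => G a b && ~~ is_edge u v a b).
Proof. by move=> a; rewrite adj_irrefl. Qed.

Definition del_edge G u v := SGraph (del_edge_sym G u v) (del_edge_irrefl G u v).

Lemma add_edge_sym G u v :
  symmetric (fun a b => G a b || (a != b) && is_edge u v a b).
Proof. by move=> a b; rewrite adj_sym is_edge_sym eq_sym. Qed.

Lemma add_edge_irrefl G u v :
  irreflexive (fun a b => G a b || (a != b) && is_edge u v a b).
Proof. by move=> a; rewrite adj_irrefl eqxx. Qed.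

(** The guard [a != b] makes this a simple graph for all [u] and [v], also when they coincide. *)
Definition add_edge G u v := SGraph (add_edge_sym G u v) (add_edge_irrefl G u v).

Definition move_edge G q v p := add_edge (del_edge G v q) p q.

Lemma independence_number_ge G (S : {set 'I_n}) :
  independent G S -> #|S| <= independence_number G.
Proof. by move=> iS; apply: leq_bigmax_cond. Qed.

Lemma max_independent G :
  exists2 S : {set 'I_n}, independent G S & #|S| = independence_number G.
Proof.
rewrite /independence_number.
have [|S iS ->] := @eq_bigmax_cond _ (independent G) (fun S : {set 'I_n} => #|S|).
  apply/card_gt0P; exists set0; apply/forall_inP => a.
  by rewrite inE.
by exists S.
Qed.

Lemma independence_number_sub G H :
  subrel H G -> independence_number G <= independence_number H.
Proof.
move=> sHG; have [S iS <-] := max_independent G.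
apply: independence_number_ge; apply/forall_inP => a aS; apply/forall_inP => b bS.
have /forall_inP /(_ a aS) /forall_inP /(_ b bS) := iS.
by apply: contra; apply: sHG.
Qed.

(** Removing [q] from a maximum independent set leaves a set that the new edge cannot spoil. *)
Lemma independence_number_add G p q :
  independence_number G <= (independence_number (add_edge G p q)).+1.
Proof.
have [S iS <-] := max_independent G.
rewrite (cardsD1 q S) -add1n leq_add ?leq_b1 //.
apply: independence_number_ge; apply/forall_inP => a; rewrite !inE => /andP [aq aS].
apply/forall_inP => b; rewrite !inE => /andP [bq bS].
have /forall_inP /(_ a aS) /forall_inP /(_ b bS) := iS.
by rewrite /= /is_edge (negbTE aq) (negbTE bq) !andbF orbF.
Qed.

Lemma independence_number_move G q v p :
  independence_number G <= (independence_number (move_edge G q v p)).+1.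
Proof.
apply: leq_trans (independence_number_add _ _ _).
by apply: independence_number_sub => a b /andP [].
Qed.

Lemma connect_graphC G a b : connect G a b = connect G b a.
Proof. by apply: sym_connect_sym; apply: adj_sym. Qed.

Lemma connected_del G u v :
  connected G -> connect (del_edge G u v) u v -> connected (del_edge G u v).
Proof.
move=> [n0 cG] cuv; split=> // x y; apply: connect_sub (cG x y) => a b ab.
have [/orP [] /andP [/eqP -> /eqP ->]|nab] := boolP (is_edge u v a b).
- by [].
- by rewrite connect_graphC.
- by apply: connect1; rewrite /= ab nab.
Qed.

(** A walk using the lost edge is rerouted from [v] to [p] and then along the new edge to [q]. *)
Lemma connected_move G q v p : p != q ->
  connected G -> connect (del_edge G v q) v p -> connected (move_edge G q v p).
Proof.
move=> pq [n0 cG] cvp; split=> // x y.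
have cvq : connect (move_edge G q v p) v q.
  apply: (@connect_trans _ _ p).
    apply: connect_sub cvp => a b ab; apply: connect1.
    by rewrite /= -[_ && _]/(del_edge G v q a b) ab.
  by apply: connect1; rewrite /= pq /is_edge !eqxx orbT.
apply: connect_sub (cG x y) => a b ab.
have [/orP [] /andP [/eqP -> /eqP ->]|nab] := boolP (is_edge v q a b).
- by [].
- by rewrite connect_graphC.
- by apply: connect1; rewrite /= ab nab.
Qed.

Lemma detour G x z l y : G x z -> path G z l -> last z l = y ->
  x \notin z :: l -> z != y -> connect (del_edge G x y) x y.
Proof.
move=> xz pl ly xl zy.
have zx : z != x by apply: contraNneq xl => ->; rewrite mem_head.
apply: (@connect_trans _ _ z).
  by apply: connect1; rewrite /= xz /is_edge (negbTE zy) (negbTE zx) !andbF.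
apply/connectP; exists l => //.
elim: l z xl pl {xz ly zy zx} => //= b l IH z.
rewrite !inE !negb_or => /and3P [xz xb xl] /andP [zb pl].
rewrite zb /is_edge ![_ == x]eq_sym (negbTE xz) (negbTE xb) !andbF /=.
by apply: IH => //; rewrite inE negb_or xb.
Qed.

(** An isolated vertex also qualifies. *)
Definition is_leaf G p := forall a b, G p a -> G p b -> a = b.

(** Extend a path at its front until all neighbours of the front vertex [x] lie on it. Either [x]
    has at most one neighbour, or a second one closes a cycle through [x]. *)
Lemma leaf_or_nonbridge G : 0 < n ->
  (exists p, is_leaf G p) \/
  (exists x y, G x y /\ connect (del_edge G x y) x y).
Proof.
move=> n0; have [k] := ubnP (n - size [:: Ordinal n0]).
have : uniq [:: Ordinal n0] by [].
have : path G (Ordinal n0) [::] by [].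
move: (Ordinal n0) [::]; elim: k => // k IH x l pl ul.
have [/existsP [y /andP [yx yl]]|] := boolP [exists y, G y x && (y \notin x :: l)].
  move=> lk; apply: (IH y (x :: l)); rewrite /= ?yx //; first by rewrite yl.
  have := max_card (mem (y :: x :: l)).
  rewrite card_ord (card_uniqP _) /=; last by rewrite yl.
  by move: lk => /=; lia.
rewrite negb_exists => /forallP nbr _.
have {}nbr y : G x y -> y \in l.
  move=> xy; have := nbr y; rewrite adj_sym xy negbK inE => /orP [/eqP yx|//].
  by move: xy; rewrite yx adj_irrefl.
case: l pl ul nbr => [|z l] pl ul nbr.
  by left; exists x => a b /nbr; rewrite in_nil.
have [/existsP [y /andP [xy yz]]|] := boolP [exists y, G x y && (y != z)].
  right; exists x, y; split=> //.
  move: pl ul => /= /andP [xz pl] /andP [xl _].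
  have yl : y \in l by have := nbr y xy; rewrite inE (negbTE yz).
  have [l1 [l2 lE]] : exists l1 l2, l = rcons l1 y ++ l2.
    by case/path.splitP: yl => l1 l2; exists l1, l2.
  apply: (@detour G x z (rcons l1 y)) => //.
  - by move: pl; rewrite lE cat_path => /andP [].
  - by rewrite last_rcons.
  - by move: xl; rewrite lE !inE mem_cat !negb_or => /and3P [-> ->].
  - by rewrite eq_sym.
rewrite negb_exists => /forallP xz; left; exists x.
have {}xz y : G x y -> y = z by move=> xy; have := xz y; rewrite xy /= negbK => /eqP.
by move=> a b /xz -> /xz ->.
Qed.

(** Two consecutive vertices contain at most one element of an independent set; the induction
    removes them in pairs, and a single leftover vertex accounts for rounding up. *)
Lemma independence_number_path G x l : path G x l -> (forall a, a \in x :: l) ->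
  uniq (x :: l) -> independence_number G <= uphalf n.
Proof.
move=> pl all_l ul; have [S iS <-] := max_independent G.
have sz : size (x :: l) = n.
  by rewrite -[RHS](card_ord n) -(card_uniqP ul); apply: eq_card => a; rewrite all_l.
rewrite -[X in uphalf X]sz.
have -> : #|S| = count (mem S) (x :: l).
  rewrite -size_filter -(card_uniqP _) ?filter_uniq //.
  by apply: eq_card => a; rewrite mem_filter all_l andbT.
move: (x :: l) (pl : sorted G (x :: l)) => {}l {pl all_l ul sz x}.
have [k] := ubnP (size l); elim: k l => // k IH [|a [|b l]] //= sl.
  by case: (a \in S).
move=> /andP [ab pl]; have := IH l; rewrite !ltnS in sl *.
move=> /(_ (ltnW sl)) -/(_ (path_sorted pl)).
have : ~~ ((a \in S) && (b \in S)).
  apply/andP => - [aS bS].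
  by have /forall_inP /(_ a aS) /forall_inP /(_ b bS) := iS; rewrite ab.
case: (a \in S); case: (b \in S) => //= _; lia.
Qed.

End EdgeSurgery.

(** * The sum of squared degrees, and pendant paths *)

Section PendantPaths.
Local Open Scope nat_scope.
Variable n : nat.
Implicit Types (G H : sgraph n) (u v p q a b : 'I_n) (l w : seq 'I_n).

(** The termination measure of the descent. The number of edges would not do, because moving an edge
    preserves it. *)
Definition degsq G := \sum_a degree G a ^ 2.

Lemma degree_sum G a : degree G a = \sum_b (G a b : nat).
Proof.
rewrite /degree -sum1_card big_mkcond; apply: eq_bigr => b _.
by rewrite inE; case: (G a b).
Qed.

Lemma sum_eq_op v : \sum_b (b == v : nat) = 1.
Proof. by rewrite (bigD1 v) //= eqxx big1 // => b /negbTE ->. Qed.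

Lemma sum_is_edge u v a : u != v ->
  \sum_b (is_edge u v a b : nat) = (a == u) + (a == v).
Proof.
move=> uv; rewrite -[RHS]/((a == u) + (a == v)).
have -> : (a == u) + (a == v) = \sum_b ((a == u) * (b == v) + (a == v) * (b == u)).
  by rewrite big_split /= -!big_distrr /= !sum_eq_op !muln1.
apply: eq_bigr => b _; rewrite /is_edge.
have [->|_] := eqVneq a u; last by case: (a == v); case: (b == u).
by rewrite (negbTE uv) /= orbF mul1n mul0n addn0.
Qed.

Lemma degree_del G u v a : G u v ->
  degree (del_edge G u v) a + ((a == u) + (a == v)) = degree G a.
Proof.
move=> uv; have neq_uv : u != v by apply: contraTneq uv => ->; rewrite adj_irrefl.
rewrite -sum_is_edge // !degree_sum -big_split; apply: eq_bigr => b _ /=.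
have [/orP [] /andP [/eqP -> /eqP ->]|_] := boolP (is_edge u v a b).
- by rewrite uv.
- by rewrite adj_sym uv.
- by rewrite andbT addn0.
Qed.

Lemma degree_add G u v a : u != v -> ~~ G u v ->
  degree (add_edge G u v) a = degree G a + ((a == u) + (a == v)).
Proof.
move=> neq_uv uv.
rewrite -sum_is_edge // !degree_sum -big_split; apply: eq_bigr => b _ /=.
have [/orP [] /andP [/eqP -> /eqP ->]|_] := boolP (is_edge u v a b).
- by rewrite neq_uv (negbTE uv).
- by rewrite adj_sym eq_sym neq_uv (negbTE uv).
- by rewrite andbF orbF addn0.
Qed.

Lemma degsq_del G u v : G u v -> degsq (del_edge G u v) < degsq G.
Proof.
move=> uv; have dE a := degree_del a uv.
rewrite /degsq (bigD1 u) //= [ltnRHS](bigD1 u) //= -addSn leq_add //.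
  by rewrite -(dE u) eqxx; nia.
by apply: leq_sum => a _; rewrite leq_exp2r // -(dE a) leq_addr.
Qed.

(** Only the degrees [d] of [v] and [e] of [p] change, to [d - 1] and [e + 1]; the sum drops by
    [2 * (d - e - 1)], positive since [d] is at least 3 and [e] at most 1. *)
Lemma degsq_move G q v p : G v q -> ~~ G p q -> p != q -> p != v ->
  degree G p <= 1 -> 2 < degree G v -> degsq (move_edge G q v p) < degsq G.
Proof.
move=> vq pq neq_pq neq_pv dp dv.
have dE a : degree (move_edge G q v p) a + (a == v) = degree G a + (a == p).
  rewrite degree_add //; last by rewrite /= (negbTE pq).
  by rewrite -(degree_del a vq); lia.
rewrite /degsq (bigD1 v) //= [ltnRHS](bigD1 v) //=.
rewrite (bigD1 p) //= [X in _ < _ + X](bigD1 p) //=.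
rewrite !addnA -addSn leq_add //.
  by have := dE v; have := dE p; rewrite !eqxx [v == p]eq_sym (negbTE neq_pv); nia.
apply: leq_sum => a /andP [av ap]; rewrite leq_exp2r //.
by have := dE a; rewrite (negbTE av) (negbTE ap) !addn0 => ->.
Qed.

(* [v :: l] is a path ending in [last v l], attached to the rest of the graph
   only through [v]. *)
Definition pendant_path G v l :=
  [/\ uniq (v :: l), forall a b, a \in l -> G a b -> b \in v :: l &
      forall i j, i < size (v :: l) -> j < size (v :: l) ->
        G (nth v (v :: l) i) (nth v (v :: l) j) = (i.+1 == j) || (j.+1 == i)].

Lemma pendant_path1 G p : pendant_path G p [::].
Proof. by split=> // [] [|i] [|j] // _ _; rewrite adj_irrefl. Qed.

Lemma pendant_path_extend G v l y : pendant_path G v l -> G v y ->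
  y \notin v :: l -> (forall b, G v b -> b \notin v :: l -> b = y) ->
  pendant_path G y (v :: l).
Proof.
move=> [ul cl nl] vy yl only_y; split.
- by rewrite cons_uniq yl.
- move=> a b; rewrite inE => /orP [/eqP -> vb|al /(cl _ _ al) bl].
    rewrite inE; case: (boolP (b \in v :: l)) => [_|/(only_y _ vb) ->].
      by rewrite orbT.
    by rewrite eqxx.
  by rewrite inE bl orbT.
(* Position 0 is [v]; the later vertices lie in [l] and have no neighbour off the old path. *)
have yj j : j < size (v :: l) -> G y (nth y (v :: l) j) = (j == 0).
  case: j => [_|j jl] /=; first by rewrite adj_sym.
  apply/negbTE; rewrite adj_sym; apply: contra yl.
  by apply: cl; apply: mem_nth.
move=> [|i] [|j] il jl; rewrite /= ?adj_irrefl //.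
- by rewrite (yj j jl) eqSS eq_sym orbF.
- by rewrite adj_sym (yj i il) eqSS eq_sym.
- by rewrite !(set_nth_default v y) // nl.
Qed.

Lemma pendant_path_sub G v l (H : sgraph n) : pendant_path G v l ->
  (forall a b, a \in v :: l -> b \in v :: l -> G a b -> H a b) ->
  path H v l.
Proof.
move=> [_ _ nl] GH; apply/(pathP v) => i il.
have iS : i < size (v :: l) by rewrite ltnW.
rewrite -[nth v l i]/(nth v (v :: l) i.+1).
by apply: GH; rewrite ?mem_nth // nl ?eqxx // ltnS.
Qed.

(** Starting from [p] alone, extend at the head [v] while it has exactly one neighbour off the path.
    With none left, the path is closed under adjacency and connectedness makes it spanning. *)
Lemma maximal_pendant_path G p : connected G ->
  exists v l, [/\ pendant_path G v l, last v l = p &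
    (forall a, a \in v :: l) \/
    (exists q r, [/\ q != r, G v q, G v r, q \notin v :: l & r \notin v :: l])].
Proof.
move=> [_ cG].
have [k] := ubnP (n - size [:: p]).
have : last p [::] = p by [].
have : pendant_path G p [::] by exact: pendant_path1.
move: {1 2 4}p [::]; elim: k => // k IH v l pl lastp lk.
have [/existsP [y /andP [vy yl]]|] :=
  boolP [exists y, G v y && (y \notin v :: l)]; last first.
  rewrite negb_exists => /forallP closed_v.
  exists v, l; split=> //; left=> a.
  have /connectP [s sP ->] := cG v a.
  have := mem_head v l; elim: s {1 2 4}v sP => //= b s IHs c /andP [cb sP] cl.
  apply: IHs => //; move: cl; rewrite inE => /orP [/eqP cv|cl].
    by move: cb (closed_v b); rewrite cv => ->; rewrite negbK.
  by case: pl => _ + _; apply; [exact: cl|].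
have [/existsP [r /and3P [vr rl ry]]|] :=
  boolP [exists r, [&& G v r, r \notin v :: l & r != y]].
  exists v, l; split=> //; right; exists r, y; split=> //.
rewrite negb_exists => /forallP only_y.
have pl' : pendant_path G y (v :: l).
  apply: pendant_path_extend => // b vb bl.
  by have := only_y b; rewrite vb bl negbK => /eqP.
have [ul _ _] := pl'; apply: IH pl' _ _ => //.
have := max_card (mem (y :: v :: l)).
rewrite card_ord (card_uniqP ul); move: lk => /=; lia.
Qed.

End PendantPaths.

(** * Reversal of a pendant path *)

Section Reflection.
Local Open Scope nat_scope.
Variables (n : nat) (G : sgraph n) (v : 'I_n) (l : seq 'I_n).
Hypothesis pl : pendant_path G v l.
Let w := v :: l.

Definition reflect_path a := if a \in w then nth v (rev w) (index a w) else a.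

Lemma pendant_path_uniq : uniq w. Proof. by case: pl. Qed.

Lemma reflect_nth i : i < size w -> reflect_path (nth v w i) = nth v w (size w - i.+1).
Proof.
by move=> iw; rewrite /reflect_path mem_nth // index_uniq ?pendant_path_uniq // nth_rev.
Qed.

Lemma reflect_mem a : (reflect_path a \in w) = (a \in w).
Proof.
rewrite /reflect_path; case: ifP => // aw.
by rewrite -mem_rev mem_nth // size_rev index_mem.
Qed.

Lemma reflect_out a : a \notin w -> reflect_path a = a.
Proof. by rewrite /reflect_path => /negbTE ->. Qed.

Lemma reflectK : involutive reflect_path.
Proof.
move=> a; have [aw|aw] := boolP (a \in w); last by rewrite !reflect_out.
have iw : index a w < size w by rewrite index_mem.
rewrite -(nth_index v aw) reflect_nth // reflect_nth; last by lia.
by congr nth; lia.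
Qed.

Lemma reflect_head : reflect_path v = last v l.
Proof.
by rewrite -[v in LHS]/(nth v w 0) reflect_nth // subn1 nth_last.
Qed.

(** A pendant path is induced: adjacency on it means positions differing by one, which reversal
    preserves. *)
Lemma reflect_adj a b : a \in w -> b \in w ->
  G (reflect_path a) (reflect_path b) = G a b.
Proof.
move=> aw bw; rewrite -(nth_index v aw) -(nth_index v bw).
move: aw bw; rewrite -!index_mem; move: (index a w) (index b w) => i j iw jw.
rewrite !reflect_nth //; case: pl => _ _ nl.
rewrite !nl -/w; move: iw jw {nl}; move: (size w) => m; lia.
Qed.

End Reflection.

(** * Moving an edge to the end of a pendant path, and the descent *)

Section Descent.
Variables (R : realType) (n : nat) (sigma : R).
Hypotheses (sigma_ge0 : 0 <= sigma) (sigma_lt1 : sigma < 1).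
Implicit Types (G H K : sgraph n) (x : 'I_n -> R).

Lemma quad_reindex (s : 'I_n -> 'I_n) (e : rel 'I_n) x : involutive s ->
  quad sigma (relpre s e) x = quad sigma e (x \o s).
Proof.
move=> sK; rewrite /quad [RHS](reindex_inj (inv_inj sK)); apply: eq_bigr => a _.
rewrite [RHS](reindex_inj (inv_inj sK)); apply: eq_bigr => b _.
by rewrite /= !sK.
Qed.

Lemma sqnorm_reindex (s : 'I_n -> 'I_n) x : involutive s ->
  sqnorm (x \o s) = sqnorm x.
Proof. by move=> sK; rewrite /sqnorm [RHS](reindex_inj (inv_inj sK)). Qed.

Let boolE := (andbF, andbT, orbF, orbT, andFb, andTb, orFb, orTb).

(* Take a nonnegative Perron vector [x] of the new graph and let [p] be the end
   of the path. If [x p <= x v], moving the edge back to [v] increases the form.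
   Otherwise move all other branches at [v] to [p] instead: this yields [G]
   again, with the path [v :: l] reversed. *)
Lemma lambda_move G v l q (p := last v l) :
  pendant_path G v l -> l != [::] -> G v q -> q \notin v :: l ->
  lambda sigma (move_edge G q v p) <= lambda sigma G.
Proof.
move=> pl l0 vq ql; have n0 : (0 < n)%N by apply: leq_trans (ltn_ord v).
have pw : p \in v :: l by exact: mem_last.
have pinl : p \in l by rewrite /p; case: (l) l0 => //= a k _; exact: mem_last.
have pv : p != v.
  by case: pl => /= /andP [vl _] _ _; apply: contraNneq vl => <-.
have qv : q != v by apply: contraNneq ql => ->; exact: mem_head.
have qp : q != p by apply: contraNneq ql => ->.
have out a b : a \in l -> b \notin v :: l -> G a b = false.
  by move=> al; apply: contraNF => ab; case: pl => _ + _; apply; [exact: al|].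
pose s := reflect_path v l; have sK : involutive s by exact: reflectK pl.
have sv : s v = p by exact: reflect_head pl.
have sp : s p = v by rewrite -sv sK.
have [x [x0 xp xE]] := perron_ge0 sigma_lt1 (move_edge G q v p) n0.
suff : exists y, sqnorm y = sqnorm x /\
    quad sigma (move_edge G q v p) x <= quad sigma G y.
  move=> [y [yx le_q]]; have := le_trans le_q (quad_le_lambda sigma G y n0).
  by rewrite xE yx ler_pM2r // ler_pM2l.
have [x_pv|/ltW x_vp] := leP (x p) (x v).
  exists x; split=> //.
  apply: (@quad_shift _ _ _ sigma_ge0 sigma_lt1 _ _ x p v) => //;
    try exact: adj_sym; try exact: adj_irrefl.
  - move=> a b; rewrite !inE !negb_or => /andP [ap av] /andP [bp bv] /=.
    by rewrite /is_edge (negbTE ap) (negbTE av) (negbTE bp) (negbTE bv) !boolE.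
  - rewrite /= /is_edge !eqxx (negbTE pv) [v == p]eq_sym (negbTE pv).
    by rewrite [p == q]eq_sym [v == q]eq_sym (negbTE qp) (negbTE qv) !boolE.
  - move=> c; rewrite !inE negb_or => /andP [cp cv].
    rewrite /= /is_edge !eqxx (negbTE pv) [v == p]eq_sym (negbTE pv).
    rewrite [p == q]eq_sym [v == q]eq_sym [p == c]eq_sym.
    rewrite (negbTE qp) (negbTE qv) (negbTE cp) (negbTE cv) !boolE.
    by have [->|_] := eqVneq c q; rewrite ?andbT ?orbF // vq out.
  - move=> c; rewrite !inE negb_or => /andP [cp cv].
    rewrite /= /is_edge [v == p]eq_sym (negbTE pv) [v == q]eq_sym (negbTE qv) /= andbF orbF.
    by case/andP.
exists (x \o s); split; first exact: sqnorm_reindex.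
(* The form of [G] at [x \o s] is that of the relabelled graph at [x], so both graphs are now
   compared at the same vector. *)
rewrite -(quad_reindex _ _ sK).
have sout a : a \notin v :: l -> s a = a by exact: reflect_out.
have smem a : (s a \in v :: l) = (a \in v :: l) by exact: reflect_mem.
have sadj a b : a \in v :: l -> b \in v :: l -> G (s a) (s b) = G a b.
  exact: reflect_adj.
apply: (@quad_shift _ _ _ sigma_ge0 sigma_lt1 _ _ x v p) => //;
  try exact: adj_sym; try exact: adj_irrefl.
- by rewrite eq_sym.
- by move=> a b /=; rewrite adj_sym.
- by move=> a /=; rewrite adj_irrefl.
- move=> a b; rewrite !inE !negb_or => /andP [av ap] /andP [bv bp] /=.
  rewrite /is_edge (negbTE ap) (negbTE av) (negbTE bp) (negbTE bv) !boolE.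
  (* Neither an inner vertex of the path nor its mirror image has a neighbour off the path. *)
  have mixed c d : c != v -> c != p -> c \in v :: l -> d \notin v :: l ->
      G c d = G (s c) (s d).
    move=> cv cp cw dw; rewrite (sout d) // !out //.
      have : s c \in v :: l by rewrite smem.
      by rewrite inE -sp (inj_eq (inv_inj sK)) (negbTE cp).
    by move: cw; rewrite inE (negbTE cv).
  have [aw|aw] := boolP (a \in v :: l); have [bw|bw] := boolP (b \in v :: l).
  + by rewrite sadj.
  + exact: mixed.
  + by rewrite adj_sym [RHS]adj_sym; apply: mixed.
  + by rewrite !sout.
- rewrite /= sv sp adj_sym /is_edge !eqxx (negbTE pv) [v == p]eq_sym (negbTE pv).
  by rewrite [p == q]eq_sym [v == q]eq_sym (negbTE qp) (negbTE qv) !boolE.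
- move=> c; rewrite !inE negb_or => /andP [cv cp].
  rewrite /= sv sp /is_edge !eqxx (negbTE pv) [v == p]eq_sym (negbTE pv).
  rewrite [p == q]eq_sym [v == q]eq_sym [p == c]eq_sym.
  rewrite (negbTE qp) (negbTE qv) (negbTE cp) (negbTE cv) !boolE.
  have [cw|cw] := boolP (c \in v :: l).
    have -> : c == q = false by apply: contraNF ql => /eqP <-.
    by rewrite -[in RHS]sv -[in X in (_ = _ + X)%N]sp !sadj ?mem_head // andbT orbF.
  rewrite (sout c) // (out p) //.
  by have [->|_] := eqVneq c q; rewrite ?andbT ?orbF ?vq // addn0.
- move=> c; rewrite !inE negb_or => /andP [cv cp].
  rewrite /= sp /is_edge eqxx (negbTE pv) [p == q]eq_sym (negbTE qp).
  rewrite [p == c]eq_sym (negbTE cp) (negbTE cv) !boolE.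
  have [cw|cw] := boolP (c \in v :: l).
    have -> : c == q = false by apply: contraNF ql => /eqP <-.
    by rewrite orbF -[in X in _ -> X]sp sadj.
  by rewrite (out p) //= (sout c) // => /eqP ->.
Qed.

(** Strong induction on [degsq G]. Surgery is applied only when the independence number exceeds
    [alpha], so losing at most one keeps it at least [alpha]. *)
Lemma reach_family alpha G : (uphalf n <= alpha)%N -> connected G ->
  (alpha <= independence_number G)%N ->
  exists2 K : sgraph n, in_family alpha K & lambda sigma K <= lambda sigma G.
Proof.
move=> le_alpha; have [k] := ubnP (degsq G); elim: k G => // k IH G /ltnSE Gk cG.
rewrite leq_eqVlt => /orP [/eqP aG|aG]; first by exists G.
have n0 := cG.1.
have [[p leaf_p]|[x [y [xy cxy]]]] := leaf_or_nonbridge G n0; last first.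
  have cH := connected_del cG cxy.
  have [||K Ka leK] := IH _ _ cH.
  - exact: leq_trans (degsq_del xy) Gk.
  - apply: leq_trans (ltnW aG) _; apply: independence_number_sub.
    by move=> a b /andP [].
  - exists K => //; apply: le_trans leK (ltW _).
    apply: (lambda_lt_sub sigma_ge0 sigma_lt1 n0 cH _ xy).
      by move=> a b /andP [].
    by rewrite /= /is_edge !eqxx andbF.
have [v [l [pl lp [all_l|[q [r [qr vq vr ql rl]]]]]]] := maximal_pendant_path p cG.
  have := independence_number_path (pendant_path_sub pl (fun _ _ _ _ => id)) all_l.
  case: pl => ul _ _ /(_ ul) le_half.
  by have := leq_trans aG (leq_trans le_half le_alpha); rewrite ltnn.
have l0 : l != [::].
  apply: contraNneq qr => l0; move: lp; rewrite l0 /= => vp.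
  by rewrite vp in vq vr; rewrite (leaf_p _ _ vq vr).
have plH : path (del_edge G v q) v l.
  apply: pendant_path_sub pl _ => a b aw bw ab; rewrite /= ab /is_edge.
  have -> : a == q = false by apply: contraNF ql => /eqP <-.
  have -> : b == q = false by apply: contraNF ql => /eqP <-.
  by rewrite andbF.
have pw : p \in v :: l by rewrite -lp mem_last.
have pq : p != q by apply: contraNneq ql => <-.
have cH : connected (move_edge G q v p).
  by apply: connected_move => //; apply/connectP; exists l.
have [||K Ka leK] := IH _ _ cH.
- apply: leq_trans Gk; apply: degsq_move => //.
  + case: pl => _ cl _; apply: contraNN ql => pq'; apply: cl pq'.
    by rewrite -lp; case: (l) l0 => //= a t _; exact: mem_last.
  + rewrite -lp; case: pl => /= /andP [vl _] _ _; apply: contraNneq vl => <-.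
    by case: (l) l0 => //= a t _; exact: mem_last.
  + by apply/card_le1_eqP => a b; rewrite !inE => pa pb; exact: leaf_p.
  (* The three neighbours of [v] are its successor on the path, [q] and [r]. *)
  + have [a va al] : exists2 a, G v a & a \in l.
      case: (l) l0 plH => //= a t _ /andP [/andP [va _] _].
      by exists a; rewrite ?mem_head.
    have aw : a \in v :: l by rewrite inE al orbT.
    have neq b : b \notin v :: l -> a != b by apply: contraNneq => <-.
    have /subset_leq_card : a |: [set q; r] \subset [set y | G v y].
      by apply/subsetP => b; rewrite !inE => /or3P [] /eqP ->.
    by rewrite cardsU1 cards2 !inE negb_or !neq // qr.
- by rewrite -ltnS; apply: leq_trans aG (independence_number_move _ _ _ _).
- exists K => //; apply: le_trans leK _; rewrite -lp.
  exact: lambda_move.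
Qed.

End Descent.

Theorem theorem1p1 (R : realType) (n alpha : nat) (sigma : R)
    (Gstar : sgraph n) :
  (uphalf n <= alpha)%N ->
  0 <= sigma -> sigma < 1 ->
  minimizer sigma alpha Gstar ->
  is_tree Gstar.
Proof.
move=> le_alpha s0 s1 [[cG aG] minG]; split=> // c c3 /andP [cyc uc].
have n0 := cG.1.
case: c c3 cyc uc => [|x [|z [|a l]]] // _ cyc.
rewrite cons_uniq => /andP [xl]; rewrite cons_uniq => /andP [zl _].
move: cyc; rewrite /cycle rcons_path => /andP [/= /andP [xz pl] yx].
(* The edge closing the cycle is deleted; the rest of the cycle is the detour around it. *)
have cxy : connect (del_edge Gstar x (last a l)) x (last a l).
  apply: (@detour _ _ x z (a :: l)) => //.
  by apply: contraNneq zl => ->; exact: mem_last.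
have xy : Gstar x (last a l) by rewrite adj_sym.
have cH := connected_del cG cxy.
have [|K Ka leK] := reach_family s0 s1 le_alpha cH.
  by rewrite -aG; apply: independence_number_sub => b d /andP [].
have : lambda sigma (del_edge Gstar x (last a l)) < lambda sigma Gstar.
  apply: (lambda_lt_sub s0 s1 n0 cH _ xy) => [b d /andP [] //|].
  by rewrite /= /is_edge !eqxx andbF.
by move=> /(le_lt_trans (le_trans (minG K Ka) leK)); rewrite ltxx.
Qed.
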